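(* Let $g\colon \mathbb{R}^{+}\times\mathbb{R}\to\mathbb{R}$ satisfy the following four conditions. (G1) $g(t,x)$ is continuous with respect to $t$ and $C^1$ with respect to $x$. (G2) For all $t\ge 0$: $g(t,x)=0$ if and only if $x=0$. (G3) For any measurable function $y\colon\mathbb{R}^+\to\mathbb{R}$, the function $t\mapsto \frac{\partial g}{\partial x}(t,y(t))$ is bounded on $\mathbb{R}^+$. (G4) For any measurable function $y\colon\mathbb{R}^+\to\mathbb{R}$, the scalar linear equation $\dot z=\frac{\partial g}{\partial x}(t,y(t))\,z$ has exponential dichotomy spectrum satisfying $\Sigma^{+}\left(\frac{\partial g}{\partial x}(t,y(t))\right)\subset(-\infty,0)$. Then the trivial solution $x=0$ of $\dot x=g(t,x)$ is globally uniformly asymptotically stable.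
   Context: $\mathbb{R}^+=[0,+\infty)$. Exponential dichotomy: let $J\subset\mathbb{R}$ be an interval and $t\mapsto A(t)\in\mathbb{R}^{n\times n}$ locally integrable on $J$. The system $\dot x=A(t)x$, with fundamental matrix $\Phi(t)$, has an exponential dichotomy on $J$ if there exist a projection $P=P^2$ and constants $K\ge1$, $\alpha>0$ such that $\|\Phi(t)P\Phi^{-1}(s)\|\le Ke^{-\alpha(t-s)}$ for all $t\ge s$, $t,s\in J$, and $\|\Phi(t)(I-P)\Phi^{-1}(s)\|\le Ke^{-\alpha(s-t)}$ for all $s\ge t$, $t,s\in J$. Exponential dichotomy spectrum: $\Sigma^+(A)=\{\gamma\in\mathbb{R}\colon \dot x=[A(t)-\gamma I]x$ does not have an exponential dichotomy on $[0,+\infty)\}$. Class $\mathcal{KL}$: a function $\beta\colon\mathbb{R}^+\times\mathbb{R}^+\to\mathbb{R}^+$ is in $\mathcal{KL}$ if for each fixed $r\ge0$ the map $s\mapsto\beta(s,r)$ is strictly increasing with $\beta(0,r)=0$, and for each fixed $s$ the map $r\mapsto\beta(s,r)$ is decreasing and tends to $0$ as $r\to\infty$. Stability: for $\dot x=g(t,x)$ with $g(t,0)=0$ for all $t\ge0$, the equilibrium $x=0$ is uniformly asymptotically stable if there exist $\beta\in\mathcal{KL}$ and $c>0$, independent of $t_0$, such that $|x(t)|\le\beta(|x(t_0)|,t-t_0)$ for all $t\ge t_0\ge0$ and all solutions with $|x(t_0)|<c$. It is globally uniformly asymptotically stable if there is $\beta\in\mathcal{KL}$ for which this estimate holds for all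 $t\geq t_0\geq 0$ and all initial values $x(t_0)$ (no restriction by $c$). *)

(* Defs.v *)
From HB Require Import structures.
From mathcomp Require Import all_boot all_order all_algebra.
From mathcomp Require Import all_classical all_reals all_analysis.
Set Implicit Arguments.
Unset Strict Implicit.
Unset Printing Implicit Defensive.
Import Order.TTheory GRing.Theory Num.Theory.
Import numFieldNormedType.Exports.
Local Open Scope classical_set_scope.
Local Open Scope ring_scope.

(* For a coefficient A that is only locally integrable, solutions of
   x' = A(t) x are understood in the sense of Caratheodory, that is, through
   the integral equation.  Integrability of A Phi together with invertibility
   (and hence continuity) of Phi forces A to be locally integrable on J. *)
Definition fundamental_matrix (R : realType) (n : nat) (J : interval R)
    (A Phi : R -> 'M[R]_n) : Prop :=
  (forall t, t \in J -> Phi t \in unitmx) /\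
  (forall s t, s \in J -> t \in J -> s <= t -> forall i j,
    lebesgue_measure.-integrable `[s, t]
      (fun u : R => ((A u *m Phi u) i j)%:E) /\
    Phi t i j - Phi s i j =
      Rintegral lebesgue_measure `[s, t] (fun u : R => (A u *m Phi u) i j)).

(* The norm on 'M[R]_n is the maximum of the absolute values of the entries;
   any other norm gives the same notion, up to the value of K.  Changing the
   fundamental matrix conjugates P, hence the existential over Phi. *)
Definition exp_dichotomy (R : realType) (n : nat) (J : interval R)
    (A : R -> 'M[R]_n) : Prop :=
  exists Phi : R -> 'M[R]_n, fundamental_matrix J A Phi /\
  exists (P : 'M[R]_n) (K alpha : R),
    [/\ P *m P = P, 1 <= K, 0 < alpha,
        forall t s, t \in J -> s \in J -> s <= t ->
          `|Phi t *m P *m invmx (Phi s)| <= K * expR (- alpha * (t - s)) &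
        forall t s, t \in J -> s \in J -> t <= s ->
          `|Phi t *m (1%:M - P) *m invmx (Phi s)|
            <= K * expR (- alpha * (s - t))].

Definition dichotomy_spectrum (R : realType) (n : nat)
    (A : R -> 'M[R]_n) : set R :=
  [set gamma : R | ~ exp_dichotomy `[0, +oo[ (fun t => A t - gamma%:M)].

(* Monotonicity in r cannot be strict, because beta 0 r = 0 for every r. *)
Definition class_KL (R : realType) (beta : R -> R -> R) : Prop :=
  [/\ forall s r : R, 0 <= s -> 0 <= r -> 0 <= beta s r,
      forall r : R, 0 <= r ->
        (forall s1 s2 : R, 0 <= s1 -> s1 < s2 -> beta s1 r < beta s2 r) /\
        beta 0 r = 0 &
      forall s : R, 0 <= s ->
        (forall r1 r2 : R, 0 <= r1 -> r1 <= r2 -> beta s r2 <= beta s r1) /\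
        beta s r @[r --> +oo] --> 0].

(* The derivative is taken within J, so it is one-sided at the endpoints. *)
Definition solution_on (R : realType) (g : R -> R -> R) (J : interval R)
    (x : R -> R) : Prop :=
  forall t, t \in J ->
    (x s - x t) / (s - t) @[s --> within [set` J] t^'] --> g t (x t).

(* Solutions live on arbitrary intervals J of [0, +oo[, so that the estimate
   applies to every solution for as long as it is defined. *)
Definition globally_uniformly_asymptotically_stable (R : realType)
    (g : R -> R -> R) : Prop :=
  exists beta : R -> R -> R, class_KL beta /\
    forall (J : interval R) (x : R -> R),
      [set` J] `<=` `[0, +oo[ -> solution_on g J x ->
      forall t0 t, t0 \in J -> t \in J -> t0 <= t ->
        `|x t| <= beta `|x t0| (t - t0).

Definition partial_x (R : realType) (g : R -> R -> R) (t x : R) : R :=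
  derive1 (g t) x.

(* Main.v *)
Require Import Defs.
From HB Require Import structures.
From mathcomp Require Import all_boot all_order all_algebra.
From mathcomp Require Import all_classical all_reals all_analysis.
From mathcomp Require Import measurable_realfun.
From mathcomp Require Import ring lra.
Import Order.TTheory GRing.Theory Num.Theory.
Import numFieldNormedType.Exports.
Local Open Scope classical_set_scope.
Local Open Scope ring_scope.

(** Put p = dg/dx and let p*(t) be the supremum of p(t, x) over x.  By the mean
    value theorem g(t, x) / x is a value of p(t, .), hence at most p*(t), so every
    solution satisfies |x(t)| <= |x(t0)| exp (int_t0^t p* ).  What is needed is
    therefore int_s^t p* <= C - alpha (t - s) with C and alpha > 0 that depend
    on g only; then C and alpha yield the comparison function
    exp C * s * exp (- alpha r).

    The hypotheses speak of one function y at a time, with constants depending on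
    y, so a single y has to represent the supremum.  A measurable y is chosen with
    p(t, x) <= p(t, y(t)) + exp (- t) for all t and x
    ([measurable_near_maximiser]).  The error term is integrable over the half-line
    (its integral is at most 1, which only enlarges C), whereas a constant error eps could not be
    absorbed, since the rate alpha attached to y would depend on eps.
    Such a y exists only if p* is finite.  This is [uniform_lipschitz]: a function
    y supported on the rationals detects that p(t, .) is bounded, uniformly, for a
    dense set of times t, and the Lipschitz bound for g(t, .) which this means
    passes to all t by continuity of g in t.

    For this y put a(t) = p(t, y(t)).  Solutions of z' = (a - gamma) z are
    multiples of exp (int (a - gamma)) ([scalar_linear_solution]), and a projection
    in dimension one is 0 or 1, so a dichotomy for gamma bounds int_s^t a either
    above with slope gamma - alpha or below with slope gamma + alpha
    ([exp_dichotomy_scalar]).  Having one of the two for every gamma >= 0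
    excludes the second one and yields the first one at gamma = 0
    ([dichotomy_gap]). *)

(** * Integrals over segments *)

Lemma bounded_integrable (R : realType) (c : R -> R) (s t M : R) :
  measurable_fun `[s, t] c -> (forall u, s <= u <= t -> `|c u| <= M) ->
  (@lebesgue_measure R).-integrable `[s, t] (EFin \o c).
Proof.
move=> mc cM; apply: measurable_bounded_integrable => //=.
  rewrite lebesgue_measure_itv/=.
  by case: ifPn => // _; rewrite -EFinB ltry.
exists M; split; first exact: num_real.
by move=> x Mx u /=; rewrite in_itv/= => su; rewrite (le_trans (cM _ su))// ltW.
Qed.

Lemma Rintegral_chasles (R : realType) (c : R -> R) (s r t : R) :
  (@lebesgue_measure R).-integrable `[s, t] (EFin \o c) -> s <= r <= t ->
  \int[lebesgue_measure]_(u in `[s, t]) c u =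
  \int[lebesgue_measure]_(u in `[s, r]) c u
  + \int[lebesgue_measure]_(u in `[r, t]) c u.
Proof.
move=> ic /andP[sr rt].
have := @Rintegral_itvB R c (BLeft s) (BRight t) r ic.
rewrite !bnd_simp => /(_ sr rt) h.
rewrite Rintegral_itv_obnd_cbnd in h; first by rewrite -h; ring.
apply: integrableS ic => //.
by apply: subset_itvr; rewrite bnd_simp.
Qed.

Lemma Rintegral_segment_cst (R : realType) (k s t : R) : s <= t ->
  \int[lebesgue_measure]_(u in `[s, t]) k = k * (t - s).
Proof.
move=> st; rewrite Rintegral_cst//= lebesgue_measure_itv/= lte_fin.
by case: ltgtP st => // ->; rewrite subrr.
Qed.

Lemma Rintegral_norm_le (R : realType) (c : R -> R) (s t M : R) : s <= t ->
  (@lebesgue_measure R).-integrable `[s, t] (EFin \o c) ->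
  (forall u, s <= u <= t -> `|c u| <= M) ->
  `|\int[lebesgue_measure]_(u in `[s, t]) c u| <= M * (t - s).
Proof.
move=> st ic cM; apply: le_trans (le_normr_Rintegral _ _) _ => //.
rewrite -Rintegral_segment_cst//; apply: le_Rintegral => //.
- by have := integrable_norm ic.
- apply: (@bounded_integrable _ (cst M) _ _ `|M|) => //.
Qed.

(** Halving an interval halves the bound, as 2 (h / 2)^2 = h^2 / 2.  This replaces
    differentiation in places where only a bounded measurable coefficient is
    available and the factors need not be differentiable. *)
Lemma quadratic_increments_constant (R : realType) (F : R -> R) (S T K : R) :
  S <= T ->
  (forall u v, S <= u -> u <= v -> v <= T -> `|F v - F u| <= K * (v - u) ^+ 2) ->
  F T = F S.
Proof.
move=> ST FK.
have FKn n u v : S <= u -> u <= v -> v <= T ->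
    `|F v - F u| <= K * (v - u) ^+ 2 * 2^-1 ^+ n.
  elim: n u v => [|n IH] u v Su uv vT; first by rewrite expr0 mulr1 FK.
  set m := (u + v) / 2.
  have um : u <= m by rewrite /m; lra.
  have mv : m <= v by rewrite /m; lra.
  have h1 := IH _ _ Su um (le_trans mv vT).
  have h2 := IH _ _ (le_trans Su um) mv vT.
  have -> : F v - F u = (F v - F m) + (F m - F u) by ring.
  apply: le_trans (ler_normD _ _) _; apply: le_trans (lerD h2 h1) _.
  rewrite le_eqVlt; apply/orP; left; apply/eqP; rewrite /m (exprS 2^-1).
  by move: (2^-1 ^+ n) => w; field.
have K0 : 0 <= K * (T - S) ^+ 2 by apply: le_trans (FK _ _ _ ST _).
apply/eqP; rewrite -subr_eq0 -normr_le0.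
have : K * (T - S) ^+ 2 * 2^-1 ^+ n @[n --> \oo] --> K * (T - S) ^+ 2 * 0.
  apply: cvgMr; apply: cvg_expr; rewrite ger0_norm; lra.
rewrite mulr0 => h.
rewrite -(cvg_lim (@Rhausdorff R) h); apply: limr_ge.
  by apply/cvg_ex; eexists; exact: h.
by apply: nearW => n; apply: FKn.
Qed.

Lemma expR_taylor1 (R : realType) (d : R) :
  `|expR d - 1 - d| <= d ^+ 2 * expR `|d|.
Proof.
have h0 := expR_ge1Dx d.
rewrite ger0_norm; last by lra.
have h1 : expR d - 1 <= d * expR d.
  have := expR_ge1Dx (- d); rewrite -(ler_pM2l (expR_gt0 d)) expRN divff ?gt_eqF ?expR_gt0//.
  lra.
have e0 := expR_gt0 d.
have [d0|d0] := leP 0 d.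
  rewrite ger0_norm//.
  have : d * (expR d - 1) <= d * (d * expR d) by apply: ler_wpM2l.
  by lra.
have h2 : 1 - expR d <= - d by lra.
have : (- d) * (1 - expR d) <= (- d) * (- d) by apply: ler_wpM2l => //; lra.
have e1 : 1 <= expR `|d| by rewrite -expR0 ler_expR.
have : d ^+ 2 * 1 <= d ^+ 2 * expR `|d| by apply: ler_wpM2l => //; apply: sqr_ge0.
lra.
Qed.

(** * Scalar linear equations with bounded measurable coefficient *)

(** With C the primitive of c, the function psi * exp (- C) has quadratically small
    increments: over a step h both psi(v) - psi(u) and psi(u) (exp d - 1), where d is
    the increment of C, equal psi(u) d up to O(h^2).  Hence it is constant. *)
Lemma scalar_linear_solution (R : realType) (c psi : R -> R) (S T M : R) :
  S <= T -> measurable_fun `[S, T] c ->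
  (forall u, S <= u <= T -> `|c u| <= M) ->
  (forall u v, S <= u -> u <= v -> v <= T ->
    (@lebesgue_measure R).-integrable `[u, v] (EFin \o (fun w => c w * psi w)) /\
    psi v - psi u = \int[lebesgue_measure]_(w in `[u, v]) (c w * psi w)) ->
  psi T = psi S * expR (\int[lebesgue_measure]_(w in `[S, T]) c w).
Proof.
move=> ST mc cM psiE.
have M0 : 0 <= M by apply: le_trans (cM S _); rewrite ?lexx.
have ic u v : S <= u -> v <= T ->
    (@lebesgue_measure R).-integrable `[u, v] (EFin \o c).
  move=> Su vT; apply: (@bounded_integrable _ _ _ _ M).
    by apply: measurable_funS mc => //; apply: subset_itv; rewrite bnd_simp.
  by move=> w /andP[uw wv]; apply: cM; rewrite (le_trans Su uw) (le_trans wv vT).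
(* psi is bounded since the indefinite integral of c * psi is continuous. *)
have [B [B0 psiB]] : exists B, 0 <= B /\ forall u, S <= u -> u <= T -> `|psi u| <= B.
  have [iT _] := psiE _ _ (lexx S) ST (lexx T).
  have cI := parameterized_integral_continuous ST iT.
  have [a _ amax] := EVT_max ST cI; have [b _ bmin] := EVT_min ST cI.
  pose I v := parameterized_integral lebesgue_measure S v (fun w => c w * psi w).
  exists (`|psi S| + (`|I a| + `|I b|)).
  split=> [|u Su uT]; first by rewrite !addr_ge0.
  have [_ h] := psiE _ _ (lexx S) Su uT.
  have -> : psi u = psi S + I u by rewrite /I /parameterized_integral -h addrC subrK.
  apply: le_trans (ler_normD _ _) _; rewrite lerD2l.
  have uST : u \in `[S, T] by rewrite in_itv/= Su uT.
  have h1 : I u <= I a := amax _ uST; have h2 : I b <= I u := bmin _ uST.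
  have h3 := ler_norm (I a); have h4 := ler_norm (- I b).
  rewrite normrN in h4; have := normr_ge0 (I a); have := normr_ge0 (I b).
  by rewrite ler_norml => *; apply/andP; split; lra.
pose C v := \int[lebesgue_measure]_(w in `[S, v]) c w.
have CB u v : S <= u -> u <= v -> v <= T -> `|C v - C u| <= M * (v - u).
  move=> Su uv vT; rewrite /C (@Rintegral_chasles _ _ S u v) ?Su ?uv//; last exact: ic.
  rewrite addrC addKr; apply: Rintegral_norm_le => //; first exact: ic.
  by move=> w /andP[uw wv]; apply: cM; rewrite (le_trans Su uw) (le_trans wv vT).
have C0 : C S = 0 by rewrite /C set_itv1 Rintegral_set1.
pose L := T - S.
pose E := expR (M * L).
have E0 : 0 <= E by apply: expR_ge0.
suff : psi T * expR (- C T) = psi S * expR (- C S).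
  rewrite C0 oppr0 expR0 mulr1 => <-.
  by rewrite -mulrA -expRD addNr expR0 mulr1.
apply: (@quadratic_increments_constant _ (fun v => psi v * expR (- C v)) _ _
  (E * (M ^+ 2 * B + B * (M ^+ 2 * E)))) => // u v Su uv vT /=.
set d := C v - C u.
have -> : psi v * expR (- C v) - psi u * expR (- C u) =
    expR (- C v) * ((psi v - psi u - d * psi u) - psi u * (expR d - 1 - d)).
  have -> : expR (- C u) = expR (- C v) * expR d by rewrite -expRD; congr expR; rewrite /d; ring.
  by ring.
have dM : `|d| <= M * (v - u) by apply: CB.
have vuL : v - u <= L by rewrite /L; lra.
have vu0 : 0 <= v - u by lra.
have MvuL : M * (v - u) <= M * L by apply: ler_wpM2l.
have dE : expR `|d| <= E by rewrite ler_expR (le_trans dM).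
rewrite normrM -[leRHS]mulrA; apply: ler_pM => //.
  rewrite ger0_norm ?expR_ge0// ler_expR.
  have := CB S v (lexx _) (le_trans Su uv) vT; rewrite C0 subr0.
  have : M * (v - S) <= M * L by apply: ler_wpM2l => //; rewrite /L; lra.
  by have := ler_norm (- C v); rewrite normrN; lra.
rewrite [leRHS]mulrDl; apply: le_trans (ler_normB _ _) _; apply: lerD.
  have [ip ->] := psiE _ _ Su uv vT.
  have -> : d = \int[lebesgue_measure]_(w in `[u, v]) c w.
    rewrite /d /C (@Rintegral_chasles _ _ S u v) ?Su ?uv//; last exact: ic.
    by rewrite addrC addKr.
  rewrite -RintegralZr//; last exact: ic.
  have icu : (@lebesgue_measure R).-integrable `[u, v] (EFin \o (fun w => c w * psi u)).
    apply: (@bounded_integrable _ _ _ _ (M * `|psi u|)).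
      apply: measurable_funM => //.
      by apply: measurable_funS mc => //; apply: subset_itv; rewrite bnd_simp.
    move=> w /andP[uw wv]; rewrite normrM; apply: ler_wpM2r => //.
    by apply: cM; rewrite (le_trans Su uw) (le_trans wv vT).
  rewrite -RintegralB//.
  have -> : M ^+ 2 * B * (v - u) ^+ 2 = M * (B * (M * (v - u))) * (v - u) by ring.
  apply: Rintegral_norm_le => //.
    exact: (integrableB _ ip icu).
  move=> w /andP[uw wv]; rewrite -mulrBr normrM; apply: ler_pM => //.
    by apply: cM; rewrite (le_trans Su uw) (le_trans wv vT).
  have [iw ->] := psiE _ _ Su uw (le_trans wv vT).
  apply: (@le_trans _ _ (M * B * (w - u))).
    apply: Rintegral_norm_le => // z /andP[uz zw]; rewrite normrM.
    have Sz := le_trans Su uz; have zT := le_trans zw (le_trans wv vT).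
    by apply: ler_pM => //; [apply: cM; rewrite Sz zT|apply: psiB].
  rewrite mulrA (mulrC B); apply: ler_wpM2l; first exact: mulr_ge0.
  by lra.
rewrite normrM -[leRHS]mulrA; apply: ler_pM => //; first by apply: psiB => //; apply: le_trans vT.
apply: le_trans (expR_taylor1 _ _) _.
rewrite [leRHS](_ : _ = (M * (v - u)) ^+ 2 * E); last by ring.
apply: ler_pM => //; first exact: sqr_ge0.
by rewrite -(ger0_norm (sqr_ge0 _)) normrX lerXn2r// nnegrE ?mulr_ge0.
Qed.

(** * Exponential dichotomies in dimension one *)

Lemma entry_le_mx_norm (R : realType) (m n : nat) (A : 'M[R]_(m, n)) i j :
  `|A i j| <= `|A|.
Proof.
rewrite [leRHS]/Num.Def.normr /= mx_normrE; apply/bigmax_geP; right.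
by exists (i, j).
Qed.

(** The first alternative comes from the projection 1, the second from the
    projection 0. *)
Lemma exp_dichotomy_scalar (R : realType) (a : R -> R) (gamma M : R) :
  measurable_fun (`[0, +oo[%classic : set R) a -> (forall t : R, 0 <= t -> `|a t| <= M) ->
  exp_dichotomy `[0, +oo[ (fun t => (a t)%:M - gamma%:M : 'M[R]_1) ->
  exists C alpha : R, 0 < alpha /\
    ((forall s t : R, 0 <= s -> s <= t ->
        \int[lebesgue_measure]_(u in `[s, t]) a u
          <= C + (gamma - alpha) * (t - s)) \/
     (forall s t : R, 0 <= s -> s <= t ->
        - C + (gamma + alpha) * (t - s)
          <= \int[lebesgue_measure]_(u in `[s, t]) a u)).
Proof.
move=> ma aM [Phi [[Phiu PhiE] [P [K [alpha [PP K1 alpha0 Ps Pu]]]]]].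
exists (ln K), alpha; split=> //.
pose psi t := Phi t 0 0.
have PhiS t : Phi t = (psi t)%:M by rewrite [LHS]mx11_scalar.
have psi0 (t : R) : 0 <= t -> psi t != 0.
  move=> t0; have := Phiu t; rewrite in_itv/= t0 => /(_ isT).
  by rewrite PhiS unitmxE det_scalar1 unitfE.
have mas (s t : R) : 0 <= s -> measurable_fun `[s, t] a.
  move=> s0; apply: measurable_funS ma => //.
  by move=> u /=; rewrite !in_itv/= => /andP[su _]; rewrite (le_trans s0 su).
have psiE (s t : R) : 0 <= s -> s <= t -> psi t = psi s *
    expR (\int[lebesgue_measure]_(u in `[s, t]) a u - gamma * (t - s)).
  move=> s0 st.
  have ia : (@lebesgue_measure R).-integrable `[s, t] (EFin \o a).
    apply: (@bounded_integrable _ _ _ _ M); first exact: mas.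
    by move=> u /andP[su _]; apply: aM; apply: le_trans su.
  have ig : (@lebesgue_measure R).-integrable `[s, t] (EFin \o (fun=> gamma)).
    by apply: (@bounded_integrable _ _ _ _ `|gamma|).
  rewrite -Rintegral_segment_cst// -RintegralB//.
  apply: (@scalar_linear_solution _ _ _ _ _ (M + `|gamma|)) => //.
  - by apply: measurable_funB => //; apply: mas.
  - move=> u /andP[su _]; apply: le_trans (ler_normB _ _) _; rewrite lerD2r.
    by apply: aM; apply: le_trans su.
  move=> u v su uv vt.
  have := PhiE u v; rewrite !in_itv/= !andbT (le_trans s0 su) (le_trans s0 (le_trans su uv)).
  move=> /(_ isT isT uv 0 0).
  have entryE w : (((a w)%:M - gamma%:M : 'M[R]_1) *m Phi w) 0 0 = (a w - gamma) * psi w.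
    by rewrite !mxE big_ord1 !mxE eqxx !mulr1n.
  move=> [iAPhi PhiB]; split.
    by apply: eq_integrable iAPhi => // w _ /=; rewrite entryE.
  by rewrite [LHS]PhiB; apply: eq_Rintegral => w _; rewrite entryE.
have lastE (s t r q : R) : 0 <= s -> 0 <= t ->
    `|Phi t *m r%:M *m invmx (Phi s)| <= q -> `|r| * `|psi t / psi s| <= q.
  move=> s0 t0; apply: le_trans.
  rewrite !PhiS -scalar_mxM invmx_scalar -scalar_mxM.
  apply: le_trans (entry_le_mx_norm _ _ _ _ 0 0); rewrite mxE eqxx mulr1n.
  by rewrite -normrM mulrCA mulrA.
have lnKE x y : expR x <= K * expR y -> x <= ln K + y.
  have K0 : 0 < K by apply: lt_le_trans K1.
  by rewrite -{1}(lnK K0) -expRD ler_expR.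
have psiq (s t : R) : 0 <= s -> s <= t -> psi t / psi s =
    expR (\int[lebesgue_measure]_(u in `[s, t]) a u - gamma * (t - s)).
  by move=> s0 st; rewrite (psiE _ _ s0 st) mulrAC divff ?mul1r// psi0.
have /orP[/eqP p0|/eqP p1] : (P 0 0 == 0) || (P 0 0 == 1).
- have : P 0 0 * P 0 0 = P 0 0 by rewrite -{3}PP !mxE big_ord1.
  by move=> /eqP; rewrite -subr_eq0 -{3}(mulr1 (P 0 0)) -mulrBr mulf_eq0 subr_eq0.
- right=> s t s0 st; have t0 := le_trans s0 st.
  have := Pu s t; rewrite !in_itv/= !andbT s0 t0.
  rewrite (mx11_scalar P) p0 raddf0 subr0 => /(_ isT isT st).
  move=> /(lastE _ _ _ _ t0 s0); rewrite normr1 mul1r.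
  rewrite -invf_div psiq// -expRN ger0_norm ?expR_ge0// => /lnKE.
  by lra.
- left=> s t s0 st; have t0 := le_trans s0 st.
  have := Ps t s; rewrite !in_itv/= !andbT s0 t0.
  rewrite (mx11_scalar P) p1 => /(_ isT isT st).
  move=> /(lastE _ _ _ _ s0 t0); rewrite normr1 mul1r.
  rewrite psiq// ger0_norm ?expR_ge0// => /lnKE.
  by lra.
Qed.

(** Let gamma0 be the infimum of the slopes gamma >= 0 for which E(s, t) is bounded
    above by C + gamma (t - s).  At gamma0 the lower alternative would contradict
    slopes close to gamma0, and the upper one would lower the infimum unless
    gamma0 < alpha, in which case the slope gamma0 - alpha is already negative.
    This is the connectedness of [0, +oo[ applied to two disjoint open sets. *)
Lemma dichotomy_gap (R : realType) (E : R -> R -> R) (M : R) :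
  (forall s t : R, 0 <= s -> s <= t -> E s t <= M * (t - s)) ->
  (forall gamma, 0 <= gamma -> exists C alpha : R, 0 < alpha /\
    ((forall s t : R, 0 <= s -> s <= t -> E s t <= C + (gamma - alpha) * (t - s)) \/
     (forall s t : R, 0 <= s -> s <= t ->
        - C + (gamma + alpha) * (t - s) <= E s t))) ->
  exists C alpha : R, 0 < alpha /\
    forall s t : R, 0 <= s -> s <= t -> E s t <= C - alpha * (t - s).
Proof.
move=> EM dich.
pose G := [set gamma : R | 0 <= gamma /\
  exists C, forall s t : R, 0 <= s -> s <= t -> E s t <= C + gamma * (t - s)].
have G0 : G !=set0.
  exists `|M|; split=> //; exists 0 => s t s0 st; rewrite add0r.
  apply: le_trans (EM _ _ s0 st) _; apply: ler_wpM2r; first by rewrite subr_ge0.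
  exact: ler_norm.
have Glb : lbound G 0 by move=> x [].
have Ginf : has_inf G by split=> //; exists 0.
have [|C [alpha [alpha0 [up|low]]]] := dich (inf G); first exact: lb_le_inf.
- have [small|large] := ltP (inf G) alpha.
    exists C, (alpha - inf G); split; first by rewrite subr_gt0.
    by move=> s t s0 st; apply: le_trans (up _ _ s0 st) _; rewrite -opprB mulNr.
  have : inf G <= inf G - alpha.
    apply: ge_inf; first by exists 0.
    by split; [rewrite subr_ge0 | exists C].
  by lra.
have [gamma [gamma0 [C' up]] gammaG] := inf_adherent alpha0 Ginf.
pose delta := inf G + alpha - gamma.
have delta0 : 0 < delta by rewrite /delta; lra.
(* At this t the two bounds with slopes differing by delta have crossed. *)
pose t := (`|C| + `|C'| + 1) / delta.
have t0 : 0 <= t by apply: divr_ge0; [rewrite !addr_ge0 | exact: ltW].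
have dt : delta * t = `|C| + `|C'| + 1 by rewrite /t mulrC divfK ?gt_eqF.
have h1 := up 0 t (lexx _) t0; have h2 := low 0 t (lexx _) t0.
have h3 := ler_norm C; have h4 := ler_norm C'.
rewrite /delta in dt.
exfalso; rewrite !subr0 in h1 h2; lra.
Qed.

(** * Derivatives and measurability *)

Lemma harmonic_quotient_cvg (R : realType) (f : R -> R) (x : R) :
  derivable f x 1 ->
  (harmonic n)^-1 * (f (harmonic n + x) - f x) @[n --> \oo] --> derive1 f x.
Proof.
move=> df; have : h^-1 * (f (h + x) - f x) @[h --> 0^'] --> derive1 f x.
  rewrite derive1E; move: df; rewrite /derivable => df.
  have := df; rewrite /derive; move: df.
  have -> : (fun h : R => h^-1 *: ((f \o shift x) (h *: 1) - f x)) =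
      (fun h : R => h^-1 * (f (h + x) - f x)).
    by apply/funext => h /=; rewrite [h%:A]mulr1.
  by [].
move=> /cvgr_dnbhsP; apply; split; last exact: cvg_harmonic.
by move=> n; rewrite gt_eqF// harmonic_gt0.
Qed.

Lemma measurable_derive1_param (R : realType) (D : set R) (g : R -> R -> R) (x : R) :
  (forall z, measurable_fun D (g^~ z)) -> (forall t, D t -> derivable (g t) x 1) ->
  measurable_fun D (fun t => derive1 (g t) x).
Proof.
move=> mg dg.
apply: (@measurable_fun_cvg _ _ _ _
  (fun n t => (harmonic n)^-1 * (g t (harmonic n + x) - g t x))).
  by move=> n; apply: measurable_funM => //; apply: measurable_funB.
by move=> t Dt; apply: harmonic_quotient_cvg; apply: dg.
Qed.

Lemma lipschitz_derive1 (R : realType) (f : R -> R) (L x : R) :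
  derivable f x 1 -> (forall u v, `|f u - f v| <= L * `|u - v|) ->
  `|derive1 f x| <= L.
Proof.
move=> df fL; have h := cvg_norm (harmonic_quotient_cvg _ _ _ df) (FF := eventually_filter).
rewrite -(cvg_lim _ h)//; apply: limr_le; first by apply/cvg_ex; eexists; exact: h.
apply: nearW => n; have h0 := @harmonic_gt0 R n.
rewrite normrM normfV mulrC ler_pdivrMr ?normr_gt0 ?gt_eqF//.
by have := fL (harmonic n + x) x; rewrite addrK.
Qed.

Lemma mean_value (R : realType) (f : R -> R) (u v : R) :
  (forall x, derivable f x 1) ->
  exists w, f v - f u = derive1 f w * (v - u).
Proof.
move=> df.
have dd (w : R) : is_derive w 1 f (derive1 f w) by rewrite derive1E; apply: derivableP.
have cf : continuous f.
  by move=> w; apply/differentiable_continuous/derivable1_diffP; apply: df.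
wlog uv : u v / u <= v => [hw|].
  have [/hw//|/ltW/hw[w fw]] := leP u v.
  by exists w; rewrite -opprB fw -mulrN opprB.
have [w _ fw] := MVT_segment uv (fun w _ => dd w) (continuous_subspaceT cf).
by exists w.
Qed.

(** Removing finitely many rationals leaves a dense set: of two rationals with index
    at least N, one has index at least N + 1. *)
Lemma exists_rat_large_index (R : realType) (N : nat) (a b : R) :
  a < b -> exists r : rat, a < ratr r < b /\ (N <= pickle r)%N.
Proof.
elim: N a b => [|N IH] a b ab.
  by have [r] := rat_in_itvoo ab; rewrite in_itv/= => rab; exists r.
have [r1 [/andP[ar1 r1b] N1]] := IH _ _ ab.
have [r2 [/andP[r12 r2b] N2]] := IH _ _ r1b.
have [N1' | ] := ltnP N (pickle r1); first by exists r1; rewrite ar1 r1b.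
have [N2' | N2' N1'] := ltnP N (pickle r2).
  by exists r2; rewrite (lt_trans ar1 r12) r2b.
have /(pcan_inj pickleK) r1r2 : pickle r1 = pickle r2.
  by apply/eqP; rewrite eqn_leq (leq_trans N1' N2) (leq_trans N2' N1).
by move: r12; rewrite r1r2 ltxx.
Qed.

Lemma measurable_countable_support (R : realType) (Q D : set R) (y : R -> R) :
  measurable D -> countable Q -> (forall t, ~ Q t -> y t = 0) -> measurable_fun D y.
Proof.
move=> mD cQ yQ _ B mB.
have mcount (A : set R) : countable A -> measurable A.
  by apply: countable_measurable => t; apply: measurable_set1.
have -> : D `&` y @^-1` B = (D `&` (Q `&` y @^-1` B)) `|` (D `&` (~` Q `&` [set _ | B 0])).
  apply/seteqP; split=> t /=.
    move=> [Dt Bt]; have [Qt|nQt] := pselect (Q t); first by left.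
    by right; rewrite -(yQ t nQt).
  by move=> [[Dt [Qt Bt]]//|[Dt [nQt B0]]]; rewrite (yQ t nQt).
apply: measurableU; apply: measurableI => //.
  by apply: mcount; apply: sub_countable cQ; apply: subset_card_le => t [].
apply: measurableI; first by apply: measurableC; apply: mcount.
have [B0|nB0] := pselect (B 0).
  by rewrite (_ : [set _ | B 0] = setT)//; apply/seteqP; split.
by rewrite (_ : [set _ | B 0] = set0)//; apply/seteqP; split.
Qed.

(** Selecting the first admissible index is measurable.  The second conclusion covers
    both the selected point and the value of a Caratheodory function at it. *)
Lemma measurable_choice_nat (R : realType) (D : set R) (A : nat -> set R) :
  measurable D -> (forall k, measurable (A k)) -> D `<=` \bigcup_k A k ->
  exists kappa : R -> nat, (forall t, D t -> A (kappa t) t) /\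
    forall F : nat -> R -> R, (forall k, measurable_fun D (F k)) ->
      measurable_fun D (fun t => F (kappa t) t).
Proof.
move=> mD mA DA.
have /choice[kappa kE] : forall t, exists k, D t -> seqDU A k t.
  move=> t; have [Dt|nDt] := pselect (D t); last by exists 0%N.
  by move: (DA _ Dt); rewrite seqDU_bigcup_eq => -[k _ kt]; exists k.
exists kappa; split; first by move=> t /kE; apply: subset_seqDU.
move=> F mF _ B mB.
have -> : D `&` (fun t => F (kappa t) t) @^-1` B =
    \bigcup_k (seqDU A k `&` (D `&` F k @^-1` B)).
  apply/seteqP; split=> t /=.
    by move=> [Dt Bt]; exists (kappa t) => //; split=> //; apply: kE.
  move=> [k _ [Ak [Dt Bt]]]; split=> //.
  suff -> : kappa t = k by [].
  by apply: (@trivIset_seqDU _ A) => //; exists t; split=> //; apply: kE.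
apply: bigcup_measurable => k _; apply: measurableI; first exact: seqDU_measurable.
exact: mF.
Qed.

(** * Uniform bounds and near-maximisers *)

Lemma near_sup (T : Type) (R : realType) (p : T -> R) (N e : R) : T -> 0 < e ->
  exists x, (forall z, p z <= p x + e) \/ N < p x.
Proof.
move=> x0 e0.
have [[x Nx]|bounded] := pselect (exists x, N < p x); first by exists x; right.
have supp : has_sup (range p).
  split; first by exists (p x0), x0.
  exists N => _ [x _ <-]; rewrite leNgt; apply/negP => Nx.
  by apply: bounded; exists x.
have [_ [x _ <-] px] := sup_adherent e0 supp.
exists x; left=> z; apply: (@le_trans _ _ (sup (range p))).
  by apply: sup_ubound; [case: supp | exists z].
by rewrite -lerBlDr ltW.
Qed.

(** A bound along each measurable y does not bound p(t, .) at one given t, since y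
    takes a single value there.  So y is chosen such that, at each rational q,
    |p(q, y(q))| nearly attains the supremum of |p(q, .)| or exceeds the index of q.
    If M bounds p along y, then |p(q, .)| <= M + 1 for all q of index at least M;
    these q are still dense. *)
Lemma uniform_lipschitz (R : realType) (g : R -> R -> R) :
  (forall x : R, {within `[0, +oo[, continuous (g^~ x)}) ->
  (forall t : R, 0 <= t -> forall x : R, derivable (g t) x 1) ->
  (forall y : R -> R, measurable_fun (`[0, +oo[%classic : set R) y ->
     exists M : R, forall t : R, 0 <= t -> `|partial_x g t (y t)| <= M) ->
  exists L : R, forall t : R, 0 <= t ->
    forall x z, `|g t x - g t z| <= L * `|x - z|.
Proof.
move=> gt gx bnd.
have /choice[Y YP] : forall q : rat, exists x, (forall z,
    `|partial_x g (ratr q) z| <= `|partial_x g (ratr q) x| + 1) \/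
    (pickle q)%:R < `|partial_x g (ratr q) x|.
  by move=> q; apply: near_sup => //; exact: 0.
pose Q : set R := range ratr.
have /choice[rk rkE] : forall t : R, exists q : rat, Q t -> ratr q = t.
  move=> t; have [[q _ <-]|nQt] := pselect (Q t); first by exists q.
  by exists 0.
pose y t := if pselect (Q t) then Y (rk t) else 0.
have my : measurable_fun (`[0, +oo[%classic : set R) y.
  apply: (@measurable_countable_support _ Q) => //.
    apply: sub_countable (countableP [set: rat]); exact: card_image_le.
  by move=> t nQt; rewrite /y; case: pselect.
have [M yM] := bnd _ my.
exists (M + 1) => t t0 x z; rewrite leNgt; apply/negP => tbig.
have rat_small (q : rat) : 0 <= ratr q :> R -> M <= (pickle q)%:R ->
    forall x, `|partial_x g (ratr q) x| <= M + 1.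
  move=> q0 qM w; have := yM _ q0.
  have -> : y (ratr q) = Y q.
    rewrite /y; case: pselect => [Qq|[]]; last by exists q.
    by have /fmorph_inj -> := rkE _ Qq.
  move=> YM; have [|] := YP q; first by move=> /(_ w) /le_trans; apply; rewrite lerD2r.
  by move=> /lt_le_trans/(_ YM)/lt_le_trans/(_ qM); rewrite ltxx.
have Dt : (`[0, +oo[%classic : set R) t by rewrite /= in_itv/= t0.
have cx := (proj1 (subspace_continuousP _ _) (gt x)) t Dt.
have cz := (proj1 (subspace_continuousP _ _) (gt z)) t Dt.
(* The set of times with an increment of g above the bound is open in [0, +oo[,
   hence contains a rational q of large index. *)
have cxz : `|g s x - g s z| @[s --> within `[0, +oo[ (nbhs t)] --> `|g t x - g t z|.
  by apply: cvg_norm; apply: cvgB cx cz.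
have nt : nbhs t (fun s => (`[0, +oo[%classic : set R) s ->
    (M + 1) * `|x - z| < `|g s x - g s z|).
  exact: (cvgr_gt _ cxz _ tbig).
have [d /= d0 dP] := proj1 (nbhs_ballP _ _) nt.
have td : t < t + d by rewrite ltrDl.
have [q [/andP[tq qd] qN]] := exists_rat_large_index _ (Num.bound `|M|) _ _ td.
have q0 : 0 <= ratr q :> R by rewrite (le_trans t0) ?ltW.
have qM : M <= (pickle q)%:R.
  apply: le_trans (ler_norm _) _; apply: ltW; apply: lt_le_trans (archi_boundP _) _ => //.
  by rewrite ler_nat.
have := dP (ratr q); rewrite /ball/= in_itv/= q0 => /(_ _ isT).
have -> : `|t - ratr q| < d by rewrite ltr_norml; apply/andP; split; lra.
move=> /(_ isT); rewrite ltNge => /negP; apply.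
have [w ->] := mean_value _ _ z x (gx _ q0).
by rewrite normrM ler_wpM2r//; apply: rat_small.
Qed.

(** By continuity of p(t, .) it suffices to compare with rational points, of which
    the first near-maximal one is taken. *)
Lemma measurable_near_maximiser (R : realType) (p : R -> R -> R) (e : R -> R) (L : R) :
  (forall x, measurable_fun (`[0, +oo[%classic : set R) (p^~ x)) ->
  (forall t : R, 0 <= t -> continuous (p t)) ->
  (forall t x : R, 0 <= t -> `|p t x| <= L) ->
  measurable_fun (`[0, +oo[%classic : set R) e -> (forall t : R, 0 <= t -> 0 < e t) ->
  exists y : R -> R, measurable_fun (`[0, +oo[%classic : set R) y /\
    measurable_fun (`[0, +oo[%classic : set R) (fun t => p t (y t)) /\
    forall t x : R, 0 <= t -> p t x <= p t (y t) + e t.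
Proof.
move=> mp cp pL me e0.
pose q k : R := ratr (odflt 0 (unpickle k : option rat)).
pose D := (`[0, +oo[%classic : set R).
have mD : measurable D by apply: measurable_itv.
pose A k := \bigcap_j (D `&` [set t | p t (q j) <= p t (q k) + e t]).
have mA k : measurable (A k).
  apply: bigcap_measurable => // j _.
  have := @measurable_fun_ler _ _ R D (p^~ (q j)) (fun t => p t (q k) + e t)
    (mp _) (measurable_funD (mp _) me) mD [set true].
  exact.
have DA : D `<=` \bigcup_k A k.
  move=> t Dt; have t0 : 0 <= t by move: Dt; rewrite /D/= in_itv/= andbT.
  have [k [kP|]] := near_sup _ _ (fun k => p t (q k)) L (e t) 0%N (e0 _ t0).
    by exists k => // j _; split=> //; apply: kP.
  by have := ler_norm (p t (q k)); have := pL t (q k) t0; lra.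
have [kappa [kA mk]] := measurable_choice_nat _ _ _ mD mA DA.
exists (fun t => q (kappa t)); split; first by apply: (mk (fun k _ => q k)).
split=> [|t x t0]; first by apply: (mk (fun k t => p t (q k))) => k; apply: mp.
have Dt : D t by rewrite /D/= in_itv/= andbT.
rewrite leNgt; apply/negP => big.
pose O := p t @^-1` `]p t (q (kappa t)) + e t, +oo[.
have oO : open O by apply: open_comp; [move=> ? _; apply: cp | exact: interval_open].
have [] := @dense_rat R O _ oO; first by exists x; rewrite /O/= in_itv/= andbT.
move=> w [Ow [r _ rw]]; move: Ow; rewrite -rw /O/= in_itv/= andbT ltNge => /negP; apply.
have := kA _ Dt (pickle r) Logic.I.
by rewrite /= /q pickleK => -[].
Qed.

(** * Solutions of the nonlinear equation *)

Lemma Rintegral_derive (R : realType) (f F : R -> R) (u v : R) : u <= v ->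
  {within `[u, v], continuous f} -> {within `[u, v], continuous F} ->
  (forall s, u < s < v -> is_derive s 1 F (f s)) ->
  \int[lebesgue_measure]_(w in `[u, v]) f w = F v - F u.
Proof.
rewrite le_eqVlt => /predU1P[-> _ _ _|uv cf cF dF].
  by rewrite set_itv1 Rintegral_set1 subrr.
rewrite /Rintegral (@continuous_FTC2 _ f F)//.
  have [_ Fu Fv] := (continuous_within_itvP F uv).1 cF.
  by split=> // s; rewrite in_itv/= => /dF[].
by move=> s; rewrite in_itv/= => suv; rewrite derive1E; have [_ ->] := dF _ suv.
Qed.

Lemma solution_is_derive (R : realType) (g : R -> R -> R) (J : interval R) (x : R -> R)
    (t0 t s : R) :
  solution_on g J x -> t0 \in J -> t \in J -> t0 < s < t ->
  is_derive s 1 x (g s (x s)).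
Proof.
move=> sol Jt0 Jt /andP[t0s st].
have JI : `]t0, t[ `<=` [set` J].
  move=> w /=; rewrite in_itv/= => /andP[t0w wt].
  by apply: (@interval_is_interval _ J t0 t) => //; rewrite !ltW.
have Js : s \in J by apply: JI; rewrite /= in_itv/= t0s.
have quot : (x w - x s) / (w - s) @[w --> s^'] --> g s (x s).
  apply: cvg_trans (sol _ Js) => A /= nA.
  have Jnear : \forall w \near s^', w \in J.
    apply: nbhs_dnbhs; apply: filterS JI _.
    by apply: near_in_itvoo; rewrite in_itv/= t0s.
  have nA' : \forall w \near s^', w \in J -> A ((x w - x s) / (w - s)) := nA.
  suff : \forall w \near s^', A ((x w - x s) / (w - s)) by [].
  by apply: filterS2 nA' Jnear => w wA Jw; apply: wA.
have quot0 : h^-1 * (x (h + s) - x s) @[h --> 0^'] --> g s (x s).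
  apply/cvgr_dnbhsP => h [h0 hl].
  have := proj1 (cvgr_dnbhsP _ _ _) quot (fun n => h n + s).
  have hs : (forall n, h n + s != s) /\ h n + s @[n --> \oo] --> s.
    split=> [n|]; first by rewrite -subr_eq0 addrK.
    by rewrite -[X in _ --> X]add0r; apply: cvgD => //; apply: cvg_cst.
  move=> /(_ hs); apply: cvg_trans; apply: near_eq_cvg; apply: nearW => n /=.
  by rewrite addrK mulrC.
have E : (fun h : R => h^-1 *: ((x \o shift s) (h *: 1) - x s)) =
    (fun h : R => h^-1 * (x (h + s) - x s)).
  by apply/funext => h /=; rewrite [h%:A]mulr1.
split; first by rewrite /derivable E; apply/cvg_ex; exists (g s (x s)).
by rewrite /derive E; apply: cvg_lim.
Qed.

Lemma solution_continuous (R : realType) (g : R -> R -> R) (J : interval R) (x : R -> R)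
    (t0 t : R) :
  solution_on g J x -> t0 \in J -> t \in J -> {within `[t0, t], continuous x}.
Proof.
move=> sol Jt0 Jt.
apply/subspace_continuousP => s st0t.
have sub : `[t0, t] `<=` [set` J].
  move=> w /=; rewrite in_itv/= => w0t.
  by apply: (@interval_is_interval _ J t0 t).
have Js := sub _ st0t.
have : x w @[w --> within [set` J] s^'] --> x s.
  have h : x s + (x w - x s) / (w - s) * (w - s) @[w --> within [set` J] s^'] -->
      x s + g s (x s) * (s - s).
    apply: cvgD; first exact: cvg_cst.
    apply: cvgM; first exact: sol.
    apply: cvgB; last exact: cvg_cst.
    apply: cvg_trans (cvg_within _) _.
    exact: nbhs_dnbhs.
  move: h; rewrite subrr mulr0 addr0; apply: cvg_trans; apply: near_eq_cvg.
  have : \forall w \near s^', w != s by exact: nbhs_dnbhs_neq.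
  by apply: filterS => w ws _; rewrite divfK ?subr_eq0// addrC subrK.
move=> xs A /= xA.
have := xs A xA => /= {}xs.
have : nbhs s (fun w => w != s -> w \in J -> A (x w)) by exact: xs.
apply: filterS => w Aw /= wt.
have [->|ws] := eqVneq w s; first exact: nbhs_singleton.
by apply: Aw => //; apply: sub.
Qed.

Lemma solution_field_continuous (R : realType) (g : R -> R -> R) (D : set R) (x : R -> R) (L : R) :
  (forall z, {within D, continuous (g^~ z)}) ->
  (forall t, D t -> forall u z, `|g t u - g t z| <= L * `|u - z|) ->
  {within D, continuous x} -> {within D, continuous (fun t => g t (x t))}.
Proof.
move=> cg gL cx; apply/subspace_continuousP => s Ds.
have xs := proj1 (subspace_continuousP _ _) cx s Ds.
have gs := proj1 (subspace_continuousP _ _) (cg (x s)) s Ds.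
have L0 : L * `|x w - x s| @[w --> within D (nbhs s)] --> L * `|x s - x s|.
  apply: cvgMr; apply: cvg_norm; apply: cvgB => //; exact: cvg_cst.
rewrite subrr normr0 mulr0 in L0.
have diff0 : g w (x w) - g w (x s) @[w --> within D (nbhs s)] --> 0.
  apply/norm_cvg0P; apply: squeeze_cvgr L0; last exact: cvg_cst.
  apply: filterS (withinT _ _) => w Dw; rewrite normr_ge0; exact: gL.
have lim : (g w (x w) - g w (x s)) + g w (x s) @[w --> within D (nbhs s)] --> 0 + g s (x s).
  by apply: cvgD.
rewrite add0r in lim; apply: cvg_trans lim; apply: near_eq_cvg.
by apply: filterS (withinT _ _) => w _; rewrite /from_subspace subrK.
Qed.

(** The inverse, with value 0 at 0, is the limit of the continuous functions
    z / (z^2 + 1 / (n + 1)). *)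
Lemma measurable_fun_inv (R : realType) (D : set R) (f : R -> R) :
  measurable_fun D f -> measurable_fun D (fun t => (f t)^-1).
Proof.
move=> mf; suff minv : measurable_fun [set: R] (fun z : R => z^-1).
  exact: (measurableT_comp minv mf).
apply: (@measurable_fun_cvg _ _ _ _ (fun n (z : R) => z / (z ^+ 2 + harmonic n))).
  move=> n; apply: continuous_measurable_fun => z.
  apply: cvgM; first exact: cvg_id.
  apply: cvgV; first by rewrite gt_eqF// ltr_wpDl ?sqr_ge0 ?harmonic_gt0.
  by apply: cvgD; [exact: exprn_continuous|exact: cvg_cst].
move=> z _; have [->|z0] := eqVneq z 0.
  rewrite invr0; apply: cvg_near_cst; apply: nearW => n; by rewrite mul0r.
have -> : z^-1 = z / (z ^+ 2 + 0) by rewrite addr0 expr2 invfM mulrA divff ?mul1r.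
apply: cvgM; first exact: cvg_cst.
apply: cvgV; first by rewrite addr0 expf_neq0.
by apply: cvgD; [exact: cvg_cst|exact: cvg_harmonic].
Qed.

(** A solution x also solves the linear equation x' = c x with
    c(u) = g(u, x(u)) / x(u) <= b(u), which has an explicit solution.  Zeros of x
    need no separate uniqueness argument: there c x = g(u, 0) = 0 whatever c is, so
    c is given the value - L, which is a lower bound of b. *)
Lemma solution_growth (R : realType) (g : R -> R -> R) (b x : R -> R) (L t0 t : R) :
  t0 <= t ->
  (forall u z, t0 <= u <= t -> `|g u z| <= L * `|z|) ->
  (forall u z, t0 <= u <= t -> z != 0 -> g u z / z <= b u) ->
  {within `[t0, t], continuous x} ->
  {within `[t0, t], continuous (fun u => g u (x u))} ->
  (forall s, t0 < s < t -> is_derive s 1 x (g s (x s))) ->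
  (@lebesgue_measure R).-integrable `[t0, t] (EFin \o b) ->
  `|x t| <= `|x t0| * expR (\int[lebesgue_measure]_(u in `[t0, t]) b u).
Proof.
move=> t0t gL gb cx cgx dx ib.
(* As 0 / 0 = 0, the second summand vanishes where x is nonzero and is - L, which
   is below b, where x vanishes. *)
pose c u := g u (x u) / x u + L * (x u / x u - 1).
have sub (u v w : R) : t0 <= u -> v <= t -> u <= w <= v -> t0 <= w <= t.
  by move=> t0u vt /andP[uw wv]; rewrite (le_trans t0u uw) (le_trans wv vt).
have g0 u : t0 <= u <= t -> g u 0 = 0.
  by move=> ut; apply/eqP; have := gL u 0 ut; rewrite normr0 mulr0 normr_le0.
have bL u : t0 <= u <= t -> - L <= b u.
  move=> ut; apply: le_trans (gb u 1 ut (oner_neq0 _)); rewrite divr1.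
  by have := gL u 1 ut; rewrite normr1 mulr1 ler_norml => /andP[].
have L0 : 0 <= L.
  have tt : t0 <= t0 <= t by rewrite lexx.
  by have := gL t0 1 tt; rewrite normr1 mulr1; apply: le_trans.
have cxE u : t0 <= u <= t -> c u * x u = g u (x u).
  move=> ut; rewrite /c; have [->|x0] := eqVneq (x u) 0.
    by rewrite mulr0 g0.
  by rewrite divff// subrr mulr0 addr0 divfK.
have cL u : t0 <= u <= t -> `|c u| <= L.
  move=> ut; rewrite /c; have [->|x0] := eqVneq (x u) 0.
    by rewrite invr0 !mulr0 add0r sub0r mulrN1 normrN ger0_norm.
  rewrite divff// subrr mulr0 addr0 normrM normfV ler_pdivrMr ?normr_gt0//.
  exact: gL.
have cb u : t0 <= u <= t -> c u <= b u.
  move=> ut; rewrite /c; have [->|x0] := eqVneq (x u) 0.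
    by rewrite invr0 !mulr0 add0r sub0r mulrN1 bL.
  by rewrite divff// subrr mulr0 addr0 gb.
have mx : measurable_fun `[t0, t] x by apply: subspace_continuous_measurable_fun.
have mc : measurable_fun `[t0, t] c.
  apply: measurable_funD; first apply: measurable_funM.
  - exact: subspace_continuous_measurable_fun.
  - exact: measurable_fun_inv.
  - apply: measurable_funM => //; apply: measurable_funB => //.
    by apply: measurable_funM => //; exact: measurable_fun_inv.
have intE (u v : R) : t0 <= u -> u <= v -> v <= t ->
    (@lebesgue_measure R).-integrable `[u, v] (EFin \o (fun w => c w * x w)) /\
    x v - x u = \int[lebesgue_measure]_(w in `[u, v]) (c w * x w).
  move=> t0u uv vt.
  have uvS : `[u, v] `<=` `[t0, t] by apply: subset_itv; rewrite bnd_simp.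
  have cuv : {within `[u, v], continuous (fun w => g w (x w))}.
    exact: continuous_subspaceW cgx.
  have cxg w : w \in (`[u, v]%classic : set R) -> c w * x w = g w (x w).
    by rewrite inE/= in_itv/= => uvw; apply: cxE; apply: sub uvw.
  split.
    have ig : (@lebesgue_measure R).-integrable `[u, v] (EFin \o (fun w => g w (x w))).
      by apply: continuous_compact_integrable => //; exact: segment_compact.
    by apply: eq_integrable ig => // w /cxg cxw /=; rewrite cxw.
  have -> : \int[lebesgue_measure]_(w in `[u, v]) (c w * x w) =
      \int[lebesgue_measure]_(w in `[u, v]) g w (x w).
    by apply: eq_Rintegral => w /cxg.
  apply/esym; apply: Rintegral_derive => //; first exact: continuous_subspaceW cx.
  move=> s /andP[us sv]; apply: dx.
  by rewrite (le_lt_trans t0u us) (lt_le_trans sv vt).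
rewrite (scalar_linear_solution _ _ _ _ _ _ t0t mc cL intE) normrM.
rewrite (ger0_norm (expR_ge0 _)) ler_wpM2l// ler_expR.
apply: le_Rintegral => //; first exact: bounded_integrable cL.
Qed.

Lemma Rintegral_expRN_le (R : realType) (s t : R) : 0 <= s -> s <= t ->
  \int[lebesgue_measure]_(u in `[s, t]) expR (- u) <= 1.
Proof.
move=> s0 st.
have dexp (u : R) : is_derive u 1 (fun u => - expR (- u)) (expR (- u)).
  by apply: is_derive_eq; rewrite mulrN1 opprK.
have cexp : continuous (fun u : R => expR (- u)).
  move=> u; apply: continuous_comp; [exact: oppr_continuous | exact: continuous_expR].
have -> : \int[lebesgue_measure]_(u in `[s, t]) expR (- u) = - expR (- t) - - expR (- s).
  apply: (Rintegral_derive _ _ (fun u => - expR (- u))) => //.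
    exact: continuous_subspaceT.
  by apply: continuous_subspaceT => u; apply: cvgN; apply: cexp.
have := expR_ge0 (- t); have : expR (- s) <= 1 by rewrite -expR0 ler_expR; lra.
by lra.
Qed.

Lemma class_KL_exponential (R : realType) (K alpha : R) : 0 < K -> 0 < alpha ->
  class_KL (fun s r => K * s * expR (- (alpha * r))).
Proof.
move=> K0 alpha0; split.
- by move=> s r s0 _; rewrite !mulr_ge0 ?expR_ge0// ltW.
- move=> r _; split; last by rewrite mulr0 mul0r.
  by move=> s1 s2 _ s12; rewrite ltr_pM2r ?expR_gt0// ltr_pM2l.
- move=> s s0; split.
    move=> r1 r2 _ r12; rewrite ler_wpM2l ?mulr_ge0 ?(ltW K0)// ler_expR lerN2.
    by rewrite ler_pM2l.
  rewrite -[X in _ --> X](mulr0 (K * s)); apply: cvgMr.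
  apply: (cvg_comp (fun r => alpha * r) (fun r => expR (- r))) (@cvgr_expR R).
  by apply: gt0_cvgMry => //; exact: cvg_id.
Qed.

Theorem theorem1 (R : realType) (g : R -> R -> R)
  (G1t : forall x : R, {within `[0, +oo[, continuous (fun t : R => g t x)})
  (G1x : forall t : R, 0 <= t ->
     (forall x : R, derivable (g t) x 1) /\ continuous (partial_x g t))
  (G2 : forall t : R, 0 <= t -> forall x : R, g t x = 0 <-> x = 0)
  (G3 : forall y : R -> R, measurable_fun (`[0, +oo[%classic : set R) y ->
     exists M : R, forall t : R, 0 <= t -> `|partial_x g t (y t)| <= M)
  (G4 : forall y : R -> R, measurable_fun (`[0, +oo[%classic : set R) y ->
     dichotomy_spectrum (fun t : R => (partial_x g t (y t))%:M : 'M[R]_1)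
       `<=` `]-oo, 0[) :
  globally_uniformly_asymptotically_stable g.
Proof.
have dg t t0 := (G1x t t0).1.
pose D := (`[0, +oo[%classic : set R).
have mD : measurable D by apply: measurable_itv.
have D0 t : D t -> 0 <= t by rewrite /D/= in_itv/= andbT.
have [L gL] := uniform_lipschitz _ _ G1t dg G3.
have pL t x : 0 <= t -> `|partial_x g t x| <= L.
  by move=> t0; apply: lipschitz_derive1 => //; [apply: dg | apply: gL].
have mp x : measurable_fun D (fun t => partial_x g t x).
  apply: measurable_derive1_param => [z|t /D0 t0]; last exact: dg.
  by apply: subspace_continuous_measurable_fun => //; apply: G1t.
have me : measurable_fun D (fun t => expR (- t)).
  by apply: measurableT_comp => //.
have [y [my [ma yP]]] := measurable_near_maximiser _ _ _ _ mp (fun t t0 => (G1x t t0).2) pL me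
  (fun t _ => expR_gt0 (- t)).
pose a t := partial_x g t (y t).
have iD (f : R -> R) (M s t : R) : measurable_fun D f ->
    (forall u, 0 <= u -> `|f u| <= M) -> 0 <= s ->
    (@lebesgue_measure R).-integrable `[s, t] (EFin \o f).
  move=> mf fM s0; apply: (@bounded_integrable _ _ _ _ M).
    apply: measurable_funS mf => // u; rewrite /D/= !in_itv/= andbT => /andP[su _].
    exact: le_trans su.
  by move=> u /andP[su _]; apply: fM; apply: le_trans su.
have aL t : 0 <= t -> `|a t| <= L by exact: pL.
pose E s t := \int[lebesgue_measure]_(u in `[s, t]) a u.
have EL (s t : R) : 0 <= s -> s <= t -> E s t <= L * (t - s).
  move=> s0 st; apply: le_trans (ler_norm _) _; apply: Rintegral_norm_le => //.
    exact: (iD _ L).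
  by move=> u /andP[su _]; apply: aL; apply: le_trans su.
have [|C [alpha [alpha0 EC]]] := dichotomy_gap _ E L EL.
  move=> gamma gamma0; apply: (@exp_dichotomy_scalar _ a gamma L) => //.
  apply: contrapT => nodich; have := G4 y my gamma nodich.
  by rewrite /= in_itv/= ltNge gamma0.
exists (fun s r => expR (C + 1) * s * expR (- (alpha * r))); split.
  by apply: class_KL_exponential => //; exact: expR_gt0.
move=> J x J0 sol t0 t Jt0 Jt t0t.
have t00 : 0 <= t0 by apply: D0; apply: J0.
have cx := solution_continuous _ _ _ _ _ _ sol Jt0 Jt.
have sub : `[t0, t] `<=` D.
  by move=> u; rewrite /D/= !in_itv/= andbT => /andP[t0u _]; apply: le_trans t0u.
have ge0 u : t0 <= u <= t -> 0 <= u by move=> /andP[t0u _]; apply: le_trans t0u.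
have g0 u : 0 <= u -> g u 0 = 0 by move=> u0; apply/(G2 u u0 0).
have ia := iD a L t0 t ma aL t00.
have ie : (@lebesgue_measure R).-integrable `[t0, t] (EFin \o (fun u => expR (- u))).
  apply: (iD _ 1) => // u u0; rewrite ger0_norm ?expR_ge0// -expR0 ler_expR; lra.
have bound : `|x t| <= `|x t0| * expR (\int[lebesgue_measure]_(u in `[t0, t]) (a u + expR (- u))).
  apply: (@solution_growth _ g _ _ L) => //.
  - move=> u z ut; have := gL u (ge0 _ ut) z 0.
    by rewrite (g0 _ (ge0 _ ut)) !subr0.
  - move=> u z ut z0; have [w] := mean_value _ _ 0 z (dg _ (ge0 _ ut)).
    by rewrite (g0 _ (ge0 _ ut)) !subr0 => ->; rewrite mulfK//; apply: yP; apply: ge0 ut.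
  - apply: (@solution_field_continuous _ _ _ _ L) => //.
      by move=> z; apply: continuous_subspaceW sub _.
    by move=> u /= ; rewrite in_itv/= => ut; apply: gL; apply: ge0 ut.
  - by move=> s; apply: solution_is_derive sol Jt0 Jt.
  - exact: (integrableD _ ia ie).
apply: le_trans bound _.
rewrite (mulrC (expR (C + 1))) -mulrA ler_wpM2l// -expRD ler_expR RintegralD//.
have := EC _ _ t00 t0t; have := Rintegral_expRN_le _ _ _ t00 t0t.
by rewrite /E; lra.
Qed.
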